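(* Let $G$ be a connected graph of order $n\ge 2$ and let $H$ be a non-trivial graph (i.e. of order at least $2$). Then $$\operatorname{dim}(G\odot H)=n\cdot \operatorname{dim}_A(H).$$
   Context: All graphs are finite, simple, undirected and loop-free. For a connected graph $G$, $d_G(x,y)$ is the length of a shortest $x$–$y$ path. A vertex $s$ distinguishes $x,y$ if $d_G(s,x)\neq d_G(s,y)$. A set $S\subseteq V(G)$ is a metric generator if every pair of distinct vertices of $G$ is distinguished by some element of $S$; $\operatorname{dim}(G)$ (metric dimension) is the minimum cardinality of a metric generator. A set $S\subseteq V(H)$ is an adjacency generator for a graph $H$ if for every two distinct vertices $x,y\in V(H)\setminus S$ there exists $s\in S$ with $|N_H(s)\cap\{x,y\}|=1$, where $N_H(s)$ is the open neighbourhood; $\operatorname{dim}_A(H)$ (adjacency dimension) is the minimum cardinality of an adjacency generator. The corona product $G\odot H$, for $G$ of order $n$ with vertices $v_1,\dots,v_n$, is obtained from one copy of $G$ and $n$ disjoint copies $H_1,\dots,H_n$ of $H$ by joining $v_i$ by an edge to every vertex of $H_i$, for each $i$. *)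

(* Defs.v *)
From mathcomp Require Import all_boot.

Set Implicit Arguments.
Unset Strict Implicit.
Unset Printing Implicit Defensive.

Record sgraph := SGraph {
  vertex :> finType;
  adj : rel vertex;
  adj_sym : symmetric adj;
  adj_irr : irreflexive adj }.

Definition connected_graph (G : sgraph) : Prop :=
  forall x y : G, connect (@adj G) x y.

Section Distance.

Variable G : sgraph.

Definition has_walk (x y : G) (k : nat) : bool :=
  [exists p : k.-tuple G, path (@adj G) x p && (last x p == y)].

(* The least length of a walk, hence the length of a shortest path (by has_walk_dist
   and dist_leq); when y is not reachable from x the value is the junk value #|G|. *)
Definition dist (x y : G) : nat := find (has_walk x y) (iota 0 #|G|).

Lemma has_walkP (x y : G) (k : nat) :
  reflect (exists p, [/\ size p = k, path (@adj G) x p & last x p = y])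
          (has_walk x y k).
Proof.
apply: (iffP existsP) => [[p /andP[xp /eqP lp]]|[p [/eqP sp xp lp]]].
  by exists p; rewrite size_tuple.
by exists (Tuple sp); rewrite /= xp lp eqxx.
Qed.

Lemma has_walk_dist (x y : G) : connect (@adj G) x y -> has_walk x y (dist x y).
Proof.
case/connectP=> p xp ->; case/shortenP: xp => q xq uq _.
have hs : has (has_walk x (last x q)) (iota 0 #|G|).
  apply/hasP; exists (size q); last by apply/has_walkP; exists q.
  by rewrite mem_iota /= add0n -/(size (x :: q)) -(card_uniqP uq) max_card.
have := nth_find 0 hs; rewrite nth_iota ?add0n //.
by move: hs; rewrite has_find size_iota.
Qed.

Lemma dist_leq (x : G) (p : seq G) :
  path (@adj G) x p -> dist x (last x p) <= size p.
Proof.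
move=> xp; rewrite leqNgt; apply/negP => lt.
have /(before_find 0) := lt.
have lt' : size p < #|G|.
  by apply: leq_trans lt _; have := find_size (has_walk x (last x p)) (iota 0 #|G|);
     rewrite size_iota.
by rewrite nth_iota // add0n; move/has_walkP; apply; exists p.
Qed.

Lemma dist_eq0 (x y : G) : (dist x y == 0) = (x == y).
Proof.
rewrite /dist; have : 0 < #|G| by apply/card_gt0P; exists x.
case: #|G| => //= n _; case: ifP => h.
  by case/has_walkP: h => p [/size0nil -> _ /= ->]; rewrite !eqxx.
by apply/esym/negP => /eqP xy; move/has_walkP: h; apply; exists [::].
Qed.

Definition distinguishes (s x y : G) : bool := dist s x != dist s y.

Definition metric_generator (S : {set G}) : bool :=
  [forall x, forall y, (x != y) ==> [exists s in S, distinguishes s x y]].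

Lemma metric_generatorT : metric_generator [set: G].
Proof.
apply/forallP=> x; apply/forallP=> y; apply/implyP=> xy.
apply/existsP; exists x; rewrite inE /= /distinguishes.
have /eqP -> : dist x x == 0 by rewrite dist_eq0.
by rewrite eq_sym dist_eq0.
Qed.

Definition metric_dim : nat :=
  #|[arg min_(S < [set: G] | metric_generator S) #|S|]|.

Definition nbhd (s : G) : {set G} := [set x | adj s x].

Definition adjacency_generator (S : {set G}) : bool :=
  [forall x in ~: S, forall y in ~: S, (x != y) ==>
     [exists s in S, #|nbhd s :&: [set x; y]| == 1]].

Lemma adjacency_generatorT : adjacency_generator [set: G].
Proof. by apply/forallP=> x; rewrite !inE. Qed.

Definition adjacency_dim : nat :=
  #|[arg min_(S < [set: G] | adjacency_generator S) #|S|]|.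

End Distance.

Section Corona.

Variables G H : sgraph.

(* inl v is the vertex v of G; inr (v, x) is the vertex x of the copy of H
   attached to v. *)
Definition corona_adj : rel (G + G * H)%type := fun a b =>
  match a, b with
  | inl u, inl v => adj u v
  | inl u, inr q => u == q.1
  | inr p, inl v => p.1 == v
  | inr p, inr q => (p.1 == q.1) && adj p.2 q.2
  end.

Lemma corona_adj_sym : symmetric corona_adj.
Proof.
case=> [u|p] [v|q] /=; [exact: adj_sym | exact: eq_sym | exact: eq_sym |].
by rewrite eq_sym adj_sym.
Qed.

Lemma corona_adj_irr : irreflexive corona_adj.
Proof. by case=> [u|p] /=; rewrite adj_irr ?andbF. Qed.

Definition corona : sgraph := SGraph corona_adj_sym corona_adj_irr.

Lemma connected_corona : connected_graph G -> connected_graph corona.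
Proof.
move=> cG.
have cl (u v : G) : connect corona_adj (inl u) (inl v).
  case/connectP: (cG u v) => p up ->.
  elim: p u up => [|w p IH] u /=; first by rewrite connect0.
  by case/andP=> uw wp; apply: connect_trans (connect1 _) (IH _ wp).
have cr (p : G * H) : connect corona_adj (inl p.1) (inr p).
  by apply: connect1; rewrite /= eqxx.
have cs (p : G * H) : connect corona_adj (inr p) (inl p.1).
  by apply: connect1; rewrite /= eqxx.
case=> [u|p] [v|q]; [exact: cl | | |].
- exact: connect_trans (cl _ _) (cr _).
- exact: connect_trans (cs _) (cl _ _).
- exact: connect_trans (cs _) (connect_trans (cl _ _) (cr _)).
Qed.

End Corona.

(* Main.v *)
Require Import Defs.
From mathcomp Require Import all_boot.

Set Implicit Arguments.
Unset Strict Implicit.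
Unset Printing Implicit Defensive.

(** A vertex outside the copy of [H] attached to [v] is equidistant from all the
    vertices of that copy, while inside the copy distances are [0], [1] or [2], with
    [1] meaning adjacency.  Hence the trace on each copy of a metric generator of the
    corona is an adjacency generator of [H].  Conversely, placing an adjacency
    generator of [H] in every copy yields a metric generator; it is nonempty because
    [H] has two vertices, and separating [v] from a vertex of its own copy of [H]
    takes a landmark in another copy, hence a second vertex of [G]. *)

(** * Distances in a connected graph *)

Section Distance.

Variable G : sgraph.

Lemma dist_refl (x : G) : dist x x = 0.
Proof. by apply/eqP; rewrite dist_eq0. Qed.

Lemma dist_adj_leq (connG : connected_graph G) (s x y : G) :
  adj x y -> dist s y <= (dist s x).+1.
Proof.
move=> xy; have /has_walkP[p [<- sp lp]] := has_walk_dist (connG s x).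
have := @dist_leq G s (rcons p y).
by rewrite rcons_path last_rcons size_rcons lp sp xy; apply.
Qed.

Lemma dist_pred (connG : connected_graph G) (s y : G) :
  y != s -> exists2 x, adj x y & (dist s x).+1 <= dist s y.
Proof.
move=> ys; have /has_walkP[p [<- sp lp]] := has_walk_dist (connG s y).
case/lastP: p sp lp => [_ /= sy|p z]; first by rewrite sy eqxx in ys.
rewrite rcons_path last_rcons size_rcons => /andP[sp pz] <-.
by exists (last s p); rewrite // ltnS dist_leq.
Qed.

(** Allows a closed formula for distances to be checked edge by edge, without handling paths. Each
    inequality is an induction along descending neighbours: those given by [f_pred] for one, by
    [dist_pred] for the other. *)
Lemma dist_unique (connG : connected_graph G) (s : G) (f : G -> nat) :
    f s = 0 -> (forall x y, adj x y -> f y <= (f x).+1) ->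
    (forall y, y != s -> exists2 x, adj x y & (f x).+1 <= f y) ->
  forall y, dist s y = f y.
Proof.
move=> fs f_adj f_pred y; apply/eqP; rewrite eqn_leq; apply/andP; split.
  have [n] := ubnP (f y); elim: n y => // n IHn y /ltnSE fy.
  have [->|/f_pred[x xy fxy]] := eqVneq y s; first by rewrite dist_refl.
  apply: leq_trans (dist_adj_leq connG s xy) (leq_trans _ fxy).
  exact/IHn/(leq_trans fxy).
have [n] := ubnP (dist s y); elim: n y => // n IHn y /ltnSE dy.
have [->|/(dist_pred connG)[x xy dxy]] := eqVneq y s; first by rewrite fs.
apply: leq_trans (f_adj x y xy) (leq_trans _ dxy).
exact/IHn/(leq_trans dxy).
Qed.

(** * Generators and dimensions *)

Lemma metric_generatorP (S : {set G}) :
  reflect (forall x y, x != y -> exists2 s, s \in S & dist s x != dist s y)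
          (metric_generator S).
Proof.
apply: (iffP forallP) => [gS x y xy|gS x].
  by have /forallP/(_ y)/implyP/(_ xy)/exists_inP := gS x.
by apply/forallP => y; apply/implyP => xy; apply/exists_inP/gS.
Qed.

Lemma metric_dim_leq (S : {set G}) : metric_generator S -> metric_dim G <= #|S|.
Proof.
rewrite /metric_dim; case: arg_minnP => [|A _ minA]; last exact: minA.
exact: metric_generatorT.
Qed.

Lemma metric_dim_witness :
  exists2 S : {set G}, metric_generator S & #|S| = metric_dim G.
Proof.
rewrite /metric_dim; case: arg_minnP => [|A gA _]; last by exists A.
exact: metric_generatorT.
Qed.

(** The intersection splits into two disjoint traces, each of cardinality 0 or 1 according to
    adjacency. *)
Lemma card_nbhd_pair (s x y : G) :
  x != y -> (#|nbhd s :&: [set x; y]| == 1) = (adj s x != adj s y).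
Proof.
move=> xy; rewrite setIUr cardsU -setIIr.
have -> : [set x] :&: [set y] = set0.
  by apply/eqP; rewrite setI_eq0 disjoints1 inE.
have cardI z : #|nbhd s :&: [set z]| = adj s z.
  case: (boolP (adj s z)) => sz.
    by rewrite (setIidPr _) ?cards1 // sub1set inE.
  by apply/eqP; rewrite cards_eq0 setI_eq0 disjoint_sym disjoints1 inE.
by rewrite setI0 cards0 subn0 !cardI; do 2!case: (adj s _).
Qed.

Lemma adjacency_generatorP (S : {set G}) :
  reflect (forall x y, x \notin S -> y \notin S -> x != y ->
             exists2 s, s \in S & adj s x != adj s y)
          (adjacency_generator S).
Proof.
apply: (iffP forall_inP) => [gS x y xS yS xy|gS x].
  have xC : x \in ~: S by rewrite inE.
  have yC : y \in ~: S by rewrite inE.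
  have /forall_inP/(_ y yC)/implyP/(_ xy)/exists_inP[s sS] := gS x xC.
  by rewrite card_nbhd_pair //; exists s.
rewrite inE => xS; apply/forall_inP => y; rewrite inE => yS.
apply/implyP => xy; apply/exists_inP; have [s sS sxy] := gS x y xS yS xy.
by exists s => //; rewrite card_nbhd_pair.
Qed.

Lemma adjacency_dim_leq (S : {set G}) :
  adjacency_generator S -> adjacency_dim G <= #|S|.
Proof.
rewrite /adjacency_dim; case: arg_minnP => [|A _ minA]; last exact: minA.
exact: adjacency_generatorT.
Qed.

Lemma adjacency_dim_witness :
  exists2 S : {set G}, adjacency_generator S & #|S| = adjacency_dim G.
Proof.
rewrite /adjacency_dim; case: arg_minnP => [|A gA _]; last by exists A.
exact: adjacency_generatorT.
Qed.

Lemma adjacency_generator_neq0 (S : {set G}) :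
  2 <= #|G| -> adjacency_generator S -> exists s, s \in S.
Proof.
move=> /card_gt1P[x [y [_ _ xy]]] /adjacency_generatorP gS.
have [xS|xS] := boolP (x \in S); first by exists x.
have [yS|yS] := boolP (y \in S); first by exists y.
by have [s sS _] := gS x y xS yS xy; exists s.
Qed.

End Distance.

(** * Distances in the corona product *)

Section Corona.

Variables G H : sgraph.
Hypothesis connG : connected_graph G.

Notation GH := (corona G H).

Definition corona_dist_inl (u : G) (b : GH) : nat :=
  match b with
  | inl v => dist u v
  | inr q => (dist u q.1).+1
  end.

(** Leaving or entering a copy of [H] passes through its centre, at the cost of one step each. The
    centre also caps distances within a copy at 2, even when [H] is disconnected. *)
Definition corona_dist_inr (p : G * H) (b : GH) : nat :=
  match b with
  | inl v => (dist p.1 v).+1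
  | inr q => if q.1 != p.1 then (dist p.1 q.1).+2
             else if q.2 == p.2 then 0 else if adj p.2 q.2 then 1 else 2
  end.

Lemma dist_inl (u : G) (b : GH) : dist (inl u : GH) b = corona_dist_inl u b.
Proof.
move: b; apply: (dist_unique (connected_corona connG)) => [|a b|b] /=.
- exact: dist_refl.
- case: a b => [v|[v x]] [w|[w y]] //=; first exact: dist_adj_leq.
  + by move/eqP->.
  + by move/eqP->; rewrite ltnW.
  + by case/andP => /eqP->.
- case: b => [v|[v x]] /= bu; last by exists (inl v) => /=.
  by have [x xv dx] := dist_pred connG bu; exists (inl x).
Qed.

Lemma dist_inr (p : G * H) (b : GH) : dist (inr p : GH) b = corona_dist_inr p b.
Proof.
case: p => w z.
move: b; apply: (dist_unique (connected_corona connG)) => [|a b|b] /=.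
- by rewrite !eqxx.
- case: a b => [v|[v x]] [t|[t y]] //=.
  + by rewrite ltnS; apply: dist_adj_leq.
  + move/eqP<-; case: eqP => //= _.
    by case: ifP => // _; case: ifP.
  + move/eqP<-; case: eqP => [->|_] /=; last by rewrite ltnW.
    by rewrite dist_refl.
  + case/andP => /eqP<- xy; case: eqP => //= _.
    (* If [x] is the landmark, its neighbour [y] has value at most 1; otherwise [x] has value at
       least 1 and [y] at most 2. *)
    case: (eqVneq x z) xy => [-> ->|_ _]; first by case: ifP.
    by do 3?case: ifP.
(* Descending neighbours: from a centre, the next centre towards [w], or the landmark if the centre
   is [w]; from another copy, its centre; from the landmark's copy, the landmark if adjacent, else
   [w]. *)
- case: b => [v|[v x]] /= bs.
    have [->|/(dist_pred connG)[x xv dx]] := eqVneq v w; last by exists (inl x).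
    by exists (inr (w, z)); rewrite /= ?eqxx.
  have [vw|vw] := eqVneq v w; last by exists (inl v); rewrite /= ?eqxx.
  have xz : x != z by apply: contra bs => /eqP->; rewrite vw.
  rewrite /= (negPf xz); case: ifP => zx.
    by exists (inr (w, z)); rewrite /= ?vw ?eqxx.
  by exists (inl w); rewrite /= ?vw ?dist_refl ?eqxx.
Qed.

(** * Lower bound: traces on the copies *)

Definition copy_trace (S : {set GH}) (v : G) : {set H} :=
  [set x | (inr (v, x) : GH) \in S].

Lemma adjacency_generator_trace (S : {set GH}) (v : G) :
  metric_generator S -> adjacency_generator (copy_trace S v).
Proof.
move/metric_generatorP => gS; apply/adjacency_generatorP => x y.
rewrite !inE => xS yS xy.
have /gS[[u|[w z]] sS] : (inr (v, x) : GH) != inr (v, y).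
- by apply: contra xy => /eqP[->].
- by rewrite !dist_inl /= eqxx.
rewrite !dist_inr /=; have [vw|_] := eqVneq v w; last by rewrite eqxx.
rewrite -vw in sS => sxy; exists z; first by rewrite inE.
(* As [z] is in the trace and [x], [y] are not, both distances are 1 or 2, so they differ only
   through adjacency. *)
move: sxy; have [xz|_] := eqVneq x z; first by rewrite xz sS in xS.
have [yz|_] := eqVneq y z; first by rewrite yz sS in yS.
by do 2!case: (adj z _).
Qed.

(** The traces count the elements of [S] lying in copies of [H]; only an inequality results because
    centres in [S] are dropped. *)
Lemma sum_card_trace (S : {set GH}) : \sum_(v : G) #|copy_trace S v| <= #|S|.
Proof.
pose tag (q : G * H) : GH := inr q.
have tag_inj : injective tag by move=> p q [].
rewrite -[#|S|](cardsID (tag @: setT)) -[leqLHS]addn0 leq_add //.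
have -> : S :&: tag @: setT = tag @: [set q | tag q \in S].
  apply/setP => b; rewrite inE; apply/andP/imsetP => [[bS /imsetP[q _ def_b]]|[q]].
    by exists q; rewrite // inE -def_b.
  by rewrite inE => qS ->; split; last exact: imset_f.
rewrite card_imset // -sum1_card (eq_bigl (fun q => tag (q.1, q.2) \in S)); last first.
  by case=> v x; rewrite inE.
rewrite -(pair_big_dep predT (fun v x => tag (v, x) \in S) (fun _ _ => 1)) /=.
apply: leq_sum => v _; rewrite sum1dep_card.
by apply/subset_leq_card/subsetP => x; rewrite !inE.
Qed.

(** * Upper bound: one generator in every copy *)

Definition copies (A : {set H}) : {set GH} :=
  [set (inr p : GH) | p in setX [set: G] A].

Lemma card_copies (A : {set H}) : #|copies A| = #|G| * #|A|.
Proof. by rewrite card_imset ?cardsX ?cardsT // => p q []. Qed.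

Lemma mem_copies (A : {set H}) (v : G) (a : H) :
  a \in A -> (inr (v, a) : GH) \in copies A.
Proof. by move=> aA; apply: imset_f; rewrite !inE. Qed.

Lemma metric_generator_copies (A : {set H}) :
    2 <= #|G| -> 2 <= #|H| -> adjacency_generator A ->
  metric_generator (copies A).
Proof.
move=> order_G order_H gA; have [a aA] := adjacency_generator_neq0 order_H gA.
have sep_sym (x y : GH) :
    (exists2 s, s \in copies A & dist s x != dist s y) ->
  exists2 s, s \in copies A & dist s y != dist s x.
  by case=> s sA sxy; exists s; rewrite // eq_sym.
have sep_center (u v : G) (x : H) :
  exists2 s, s \in copies A & dist s (inl u : GH) != dist s (inr (v, x) : GH).
  have [<-|uv] := eqVneq u v; last first.
    exists (inr (u, a)); first exact: mem_copies.
    by rewrite !dist_inr /= dist_refl (eq_sym v) uv.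
  (* Seen from the copy at any other [w], the centre [u] is exactly one step nearer than [x]. *)
  have [w wu] : exists w, w != u.
    case/card_gt1P: order_G => x1 [x2 [_ _ x12]].
    have [<-|] := eqVneq x1 u; last by exists x1.
    by exists x2; rewrite eq_sym.
  exists (inr (w, a)); first exact: mem_copies.
  by rewrite !dist_inr /= (eq_sym u) wu eqSS neq_ltn ltnSn.
apply/metric_generatorP => -[u|[u x]] [v|[v y]] xy.
- exists (inr (u, a)); first exact: mem_copies.
  by rewrite !dist_inr /= dist_refl eqSS eq_sym dist_eq0.
- exact: sep_center.
- exact/sep_sym/sep_center.
(* For different copies, a landmark in the copy at [u] is within 2 of [x] but at least 3 away from
   [y]. *)
have [uv|uv] := eqVneq u v; last first.
  exists (inr (u, a)); first exact: mem_copies.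
  rewrite !dist_inr /= eqxx (eq_sym v) uv /=.
  have : dist u v != 0 by rewrite dist_eq0.
  by case: (dist u v) => // n _; do 2?case: ifP.
subst v; have {}xy : x != y by apply: contra xy => /eqP->.
have sep_mem z t : z \in A -> z != t ->
    exists2 s, s \in copies A & dist s (inr (u, z) : GH) != dist s (inr (u, t) : GH).
  move=> zA zt; exists (inr (u, z)); first exact: mem_copies.
  by rewrite !dist_inr /= !eqxx /= (eq_sym t) (negPf zt); case: (adj z t).
have [xA|xA] := boolP (x \in A); first exact: sep_mem.
have [yA|yA] := boolP (y \in A); first by apply/sep_sym/sep_mem; rewrite // eq_sym.
have /adjacency_generatorP/(_ x y xA yA xy)[s sA sxy] := gA.
exists (inr (u, s)); first exact: mem_copies.
rewrite !dist_inr /= eqxx /=.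
have [xs|_] := eqVneq x s; first by rewrite xs sA in xA.
have [ys|_] := eqVneq y s; first by rewrite ys sA in yA.
by move: sxy; do 2!case: (adj s _).
Qed.

End Corona.

Theorem theorem1 (G H : sgraph) (connG : connected_graph G)
    (order_G : 2 <= #|G|) (order_H : 2 <= #|H|) :
  metric_dim (corona G H) = #|G| * adjacency_dim H.
Proof.
apply/eqP; rewrite eqn_leq; apply/andP; split.
  have [A gA <-] := adjacency_dim_witness H; rewrite -(card_copies G A).
  exact/metric_dim_leq/metric_generator_copies.
have [S gS <-] := metric_dim_witness (corona G H).
apply: leq_trans (sum_card_trace S).
rewrite -sum_nat_const; apply: leq_sum => v _.
exact/adjacency_dim_leq/adjacency_generator_trace.
Qed.
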